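(* Suppose $\theta\in[0,2\pi)$ with $\cos\theta\in\mathbb{Q}\setminus\frac12\mathbb{Z}$. Then there exists $c>0$ such that $\theta$ satisfies $\mathrm{DPV}(n,R)$ for all sufficiently large $n$ and all $R<\exp(cn/(\log n)^2)$. That is, for all sufficiently large $n$, $$R_{\mathrm{DPV}}(n,\theta)\ge\exp(cn/(\log n)^2).$$
   Context: Dense polynomial values: $\theta$ satisfies $\mathrm{DPV}(n,R)$ if the set $$\Big\{\log\Big(\sum_{j=0}^D c_je^{ij\theta}\Big)\ \Big|\ D\ge0,\ c_j\in\mathbb{Z},\ \sum_{j=0}^D(1+|c_j|)\le n\Big\}$$ (over those sums that are nonzero) forms a $0.1$-net in $[-\log R,0]\times[0,2\pi]\subset\mathbb{C}$, i.e. every point of this rectangle is within distance $0.1$ of a point of the set. Here $\log w=\log|w|+i\arg w$ with $\arg w\in[0,2\pi)$, and $\mathbb{C}$ is identified with $\mathbb{R}^2$ via real and imaginary parts. Further, $R_{\mathrm{DPV}}(n,\theta):=\sup\{R\in\mathbb{R}\mid\theta\text{ satisfies }\mathrm{DPV}(n,R)\}$. *)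

(* Defs.v *)
From HB Require Import structures.
From mathcomp Require Import all_boot all_order all_algebra.
From mathcomp Require Import all_classical all_reals all_analysis.
From mathcomp Require Import complex.

Set Implicit Arguments.
Unset Strict Implicit.
Unset Printing Implicit Defensive.

Import Order.TTheory GRing.Theory Num.Theory.
Import numFieldNormedType.Exports.
Import ComplexField.Normc.

Local Open Scope classical_set_scope.
Local Open Scope complex_scope.
Local Open Scope ring_scope.

Local Notation Re := complex.Re.
Local Notation Im := complex.Im.

Section complex_logarithm.
Context {R : realType}.
Implicit Types (t : R) (w : R[i]).

(* e^{it} *)
Definition expi t : R[i] := cos t +i* sin t.

(* The junk value [arg 0] is irrelevant: only nonzero sums are considered. *)
Definition arg w : R :=
  xget 0 [set t | 0 <= t < pi *+ 2 /\ w = (normc w)%:C * expi t].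

Definition clog w : R[i] := ln (normc w) +i* arg w.

Lemma polarE w t : w = (normc w)%:C * expi t <->
  Re w = normc w * cos t /\ Im w = normc w * sin t.
Proof.
case: w => a b; rewrite /expi; set r := normc _.
have -> : r%:C * (cos t +i* sin t) = (r * cos t) +i* (r * sin t).
  by rewrite /real_complex_def; simpc.
by split=> [[-> ->]|/= [-> ->]].
Qed.

Lemma arg_exists w :
  exists t, 0 <= t < pi *+ 2 /\ w = (normc w)%:C * expi t.
Proof.
have pi0 := pi_gt0 R.
have [->|w0] := eqVneq w 0.
  exists 0; split; first by rewrite lexx mulrn_wgt0.
  by rewrite normc0 /= mul0r.
suff [t t01 tw] : exists2 t, 0 <= t < pi *+ 2 &
    Re w = normc w * cos t /\ Im w = normc w * sin t.
  by exists t; split=> //; apply/polarE.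
have r0 : normc w != 0 by apply: contra w0 => /eqP/eq0_normc ->.
have rE : normc w ^+ 2 = Re w ^+ 2 + Im w ^+ 2.
  by case: w {w0 r0} => a b /=; rewrite sqr_sqrtr // addr_ge0 ?sqr_ge0.
have rge0 : 0 <= normc w by case: w {w0 r0 rE} => a b /=; exact: sqrtr_ge0.
have rgt0 : 0 < normc w by rewrite lt0r r0.
move: (normc w) r0 rE rge0 rgt0 => r r0 rE rge0 rgt0.
set x := Re w / r; set y := Im w / r.
have xy : x ^+ 2 + y ^+ 2 = 1.
  by rewrite !expr_div_n -mulrDl -rE divff // expf_neq0.
have xE : Re w = r * x by rewrite mulrC divfK.
have yE : Im w = r * y by rewrite mulrC divfK.
have x1 : -1 <= x <= 1.
  by rewrite -ler_norml -(ler_pXn2r (n := 2)) ?nnegrE // expr1n -normrX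
    ger0_norm ?sqr_ge0 // -xy lerDl sqr_ge0.
have sE : sin (acos x) = `|y|.
  rewrite sin_acos // -sqrtr_sqr; congr Num.sqrt.
  by rewrite -xy addrAC subrr add0r.
have [/andP[a0 api] aK] := acos_def x1.
have [y0|y0] := leP 0 y.
  exists (acos x); last by rewrite aK sE ger0_norm.
  by rewrite a0 /= (le_lt_trans api) // mulr2n ltrDl.
exists (pi *+ 2 - acos x).
  rewrite subr_ge0 (le_trans api) /=; last by rewrite mulr2n lerDl ltW.
  rewrite ltrBlDr ltrDl lt_neqAle a0 andbT.
  apply: contraTneq (y0) => ax0; move: sE; rewrite -ax0 sin0 => /esym/eqP.
  by rewrite normr_eq0 => /eqP ->; rewrite ltxx.
have c : cos (pi *+ 2 - acos x) = x.
  by rewrite addrC cosD2pi cosN aK.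
have s : sin (pi *+ 2 - acos x) = y.
  by rewrite addrC sinD2pi sinN sE ltr0_norm ?opprK.
by rewrite c s.
Qed.

Lemma argP w : 0 <= arg w < pi *+ 2 /\ w = (normc w)%:C * expi (arg w).
Proof.
have [t tP] := arg_exists w.
exact: (@xgetPex _ 0 [set t | 0 <= t < pi *+ 2 /\ w = (normc w)%:C * expi t]
  (ex_intro _ t tP)).
Qed.

Lemma arg_unique w t : w != 0 -> 0 <= t < pi *+ 2 ->
  w = (normc w)%:C * expi t -> arg w = t.
Proof.
move=> w0 tI /polarE[cw sw]; have [] := argP w.
move: (arg w) => u uI /polarE[]; rewrite {}cw {}sw.
have r0 : normc w != 0 by apply: contra w0 => /eqP/eq0_normc ->.
move=> /(mulfI r0) ec /(mulfI r0) es.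
wlog tu : t u tI uI ec es / t <= u.
  by move=> H; have [/H->//|/ltW/H->//] := leP t u.
have : sin ((u - t) / 2) == 0.
  have c1 : cos (u - t) = 1.
    by rewrite cosB -ec -es -!expr2 cos2Dsin2.
  have h : u - t = ((u - t) / 2) *+ 2 by rewrite -mulr_natr divfK.
  move: c1; rewrite {1}h cos_mulr2n cos2sin2.
  move=> /eqP; rewrite mulrnBl -addrA [_ - 1 as X in _ + X]addrC addrA.
  by rewrite mulr2n addrK subr_eq addrC -subr_eq subrr eq_sym mulrn_eq0 sqrf_eq0.
have [//|tlu] := eqVneq u t.
have tu' : t < u by rewrite lt_neqAle eq_sym tlu.
rewrite gt_eqF // sin_gt0_pi // divr_gt0 ?subr_gt0 //=.
rewrite ltr_pdivrMr // mulr_natr.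
case/andP: tI => t0 _; case/andP: uI => _ u2.
by rewrite ltrBlDr (lt_le_trans u2) // lerDl.
Qed.

End complex_logarithm.

Section dense_polynomial_values.
Context {R : realType}.
Implicit Types (n : nat) (r theta : R).

Definition poly_value D (c : 'I_D.+1 -> int) theta : R[i] :=
  \sum_(j < D.+1) (c j)%:~R * expi (j%:R * theta).

Definition log_poly_values n theta : set R[i] :=
  [set z | exists D (c : 'I_D.+1 -> int),
     [/\ (\sum_(j < D.+1) (1 + `|c j|) <= n)%N,
         poly_value c theta != 0 &
         z = clog (poly_value c theta)]].

Definition is_net (eps : R) (S A : set R[i]) : Prop :=
  forall z, A z -> exists2 s, S s & normc (z - s) <= eps.

(* Where log r is undefined, i.e. for r <= 0, [ln r = 0], so that [rectangle r]
   is [rectangle 1]. For 0 < r < 1 the rectangle is empty. *)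
Definition rectangle r : set R[i] :=
  [set z | - ln r <= Re z <= 0 /\ 0 <= Im z <= pi *+ 2].

Definition DPV n r theta : Prop :=
  is_net (1 / 10) (log_poly_values n theta) (rectangle r).

Definition R_DPV n theta : \bar R :=
  ereal_sup [set r%:E | r in [set r | DPV n r theta]].

End dense_polynomial_values.

(* Main.v *)
(* Put z = e^{i theta} and 2 cos theta = p/q in lowest terms, so q >= 2 and
   q z^2 - p z + q = 0. If u p + v q = 1, the integer polynomial
   g = u (X^2 + 1) + v X satisfies g(z) = z/q. As 1 and z form a real basis of
   the plane, the values (a + b z) (z/q)^m of (a + b X) g^m, of degree at most
   2m + 1, approximate every complex number up to 2 q^{-m}. Adding multiples of
   X^j (q X^2 - p X + q) brings the coefficients of index >= 2 into [0, q), and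
   the two remaining ones are then O(m) when the value is bounded. Hence all
   coefficients together weigh O(m), and DPV(n, R) holds even for
   R = exp(c n). *)

Require Import Defs.
From HB Require Import structures.
From mathcomp Require Import all_boot all_order all_algebra.
From mathcomp Require Import all_classical all_reals all_analysis.
From mathcomp Require Import complex ring lra zify.

Import Order.TTheory GRing.Theory Num.Theory.
Import numFieldNormedType.Exports.

Local Open Scope classical_set_scope.
Local Open Scope ring_scope.

Local Notation normc := ComplexField.Normc.normc.
Local Notation normcM := ComplexField.Normc.normcM.
Local Notation evalz P z := (map_poly intr P).[z].

(** * Modulus on [R[i]], powers of e^{it} and the lattice they span *)

Section modulus.
Context {R : realType}.
Implicit Types (t x : R) (v w : R[i]).

Lemma normc_ge0 w : 0 <= normc w.
Proof. by case: w => a b; exact: sqrtr_ge0. Qed.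

Lemma normc_real x : normc x%:C%C = `|x|.
Proof. by rewrite /= expr0n addr0 sqrtr_sqr. Qed.

Lemma ler_normcD v w : normc (v + w) <= normc v + normc w.
Proof. exact: le_normcD. Qed.

Lemma normcX w n : normc (w ^+ n) = normc w ^+ n.
Proof.
by elim: n => [|n IHn]; rewrite ?expr0 ?ComplexField.Normc.normc1 // !exprS normcM IHn.
Qed.

Lemma ler_Re_normc w : `|complex.Re w| <= normc w.
Proof.
by case: w => a b /=; rewrite -sqrtr_sqr ler_sqrt ?addr_ge0 ?sqr_ge0 // lerDl sqr_ge0.
Qed.

Lemma ler_Im_normc w : `|complex.Im w| <= normc w.
Proof.
by case: w => a b /=; rewrite -sqrtr_sqr ler_sqrt ?addr_ge0 ?sqr_ge0 // lerDr sqr_ge0.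
Qed.

Lemma normc_le_Re_Im w : normc w <= `|complex.Re w| + `|complex.Im w|.
Proof.
case: w => a b /=.
rewrite -[leRHS]ger0_norm ?addr_ge0 // -sqrtr_sqr ler_sqrt ?sqr_ge0 //.
by rewrite sqrrD !real_normK ?num_real // addrAC lerDl mulrn_wge0 ?mulr_ge0.
Qed.

Lemma normc_int (k : int) : normc (k%:~R : R[i]) = `|k%:~R|.
Proof. by rewrite -(rmorph_int (real_complex R)) /= expr0n addr0 sqrtr_sqr. Qed.

Lemma normc_expi t : normc (expi t) = 1.
Proof. by rewrite /= cos2Dsin2 sqrtr1. Qed.

Lemma expi0 : expi 0 = 1 :> R[i].
Proof. by rewrite /expi cos0 sin0. Qed.

Lemma expiD t t' : expi (t + t') = expi t * expi t'.
Proof.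
by rewrite /expi; simpc; rewrite cosD sinD [cos t * sin t' + _]addrC.
Qed.

Lemma expiX t n : expi (n%:R * t) = expi t ^+ n.
Proof.
elim: n => [|n IHn]; first by rewrite mul0r expr0 expi0.
by rewrite exprS -IHn -expiD; congr expi; rewrite mulrSr mulrDl mul1r addrC.
Qed.

(** The roots of X^2 - 2 cos t X + 1 are e^{it} and its conjugate. Clearing the denominator of 2 cos
    t turns this into the integer relation used for all reductions below. *)
Lemma expi_sqr t : expi t ^+ 2 = (2 * cos t)%:C%C * expi t - 1.
Proof.
rewrite expr2 /expi; simpc.
apply/eqP; rewrite eq_complex /=; apply/andP; split; apply/eqP; last by ring.
by have := cos2Dsin2 t; lra.
Qed.

(* [1, e^{it}] is a real basis of the complex plane, so integer combinations of
   it are 2-dense. *)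
Lemma expi_lattice_net t w : sin t != 0 ->
  exists a b : int, normc (a%:~R + b%:~R * expi t - w) <= 2.
Proof.
case: w => x y s0; set b := y / sin t; set a := x - b * cos t.
exists (Num.floor a), (Num.floor b).
set fa := Num.floor a; set fb := Num.floor b.
have -> : fa%:~R + fb%:~R * expi t - (x +i* y)%C =
    (fa%:~R - a)%:C%C + (fb%:~R - b)%:C%C * expi t.
  rewrite -!(rmorph_int (real_complex R)) /= /expi /real_complex_def; simpc.
  apply/eqP; rewrite eq_complex /=; apply/andP; split; apply/eqP.
    by rewrite /a; ring.
  by rewrite /b; field.
apply: le_trans (ler_normcD _ _) _.
rewrite normcM normc_expi mulr1 !normc_real.
have H (u : R) : `|(Num.floor u)%:~R - u| <= 1.
  have := floor_le u; have := floorD1_gt u; rewrite intrD => h1 h2.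
  by rewrite ler0_norm; lra.
by have := H a; have := H b; lra.
Qed.

End modulus.

(** * Integer polynomials at a root of q X^2 - p X + q *)

Section integer_evaluation.
Context {K : comNzRingType}.
Implicit Types (z : K) (P Q : {poly int}).

Lemma evalzD z P Q : evalz (P + Q) z = evalz P z + evalz Q z.
Proof. by rewrite rmorphD hornerD. Qed.

Lemma evalzN z P : evalz (- P) z = - evalz P z.
Proof. by rewrite rmorphN hornerN. Qed.

Lemma evalzM z P Q : evalz (P * Q) z = evalz P z * evalz Q z.
Proof. by rewrite rmorphM hornerM. Qed.

Lemma evalzZ z a P : evalz (a *: P) z = a%:~R * evalz P z.
Proof. by rewrite map_polyZ hornerZ. Qed.

Lemma evalzC z a : evalz a%:P z = a%:~R.
Proof. by rewrite map_polyC hornerC. Qed.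

Lemma evalzX z : evalz 'X z = z.
Proof. by rewrite map_polyX hornerX. Qed.

Lemma evalzXn z n : evalz 'X^n z = z ^+ n.
Proof. by rewrite map_polyXn hornerXn. Qed.

Lemma evalz_exp z P n : evalz (P ^+ n) z = evalz P z ^+ n.
Proof. by rewrite rmorphXn horner_exp. Qed.

Definition evalzE := (evalzD, evalzN, evalzM, evalzZ, evalzC, evalzXn, evalzX).

End integer_evaluation.

(** The coefficients are reduced from the top down: subtracting a multiple of X^N (q X^2 - p X + q)
    keeps the value at z and, below index N + 2, changes only the indices N and N + 1, which the
    induction has not yet treated. *)
Lemma reduce_coefs (K : comNzRingType) (z : K) (p q : int) N (P : {poly int}) :
    0 < q -> q%:~R * z ^+ 2 = p%:~R * z - q%:~R -> (size P <= N.+2)%N ->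
  exists P' : {poly int}, [/\ (size P' <= N.+2)%N, evalz P' z = evalz P z &
    forall j, (2 <= j)%N -> `|P'`_j| <= q].
Proof.
move=> q_gt0 zE; elim: N P => [|N IHN] P sP.
  by exists P; split=> // j j2; rewrite nth_default ?(leq_trans sP) // normr0 ltW.
pose d := (P`_N.+2 %/ q)%Z; pose r := (P`_N.+2 %% q)%Z.
pose f : {poly int} := q *: 'X^2 - p *: 'X + q%:P.
(* The remainder term is removed as well, so that the size drops and the induction applies; it is
   added back to the result. *)
pose P1 : {poly int} := P - d *: ('X^N * f : {poly int}) - r *: 'X^(N.+2).
have [|P2 [sP2 P2E P2q]] := IHN P1.
  apply/leq_sizeP => j; rewrite leq_eqVlt => /predU1P[<-|jN].
    rewrite /P1 /f !coefE eqxx -[N.+2]/(2 + N)%N addnK ltnNge leq_addl /=.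
    by rewrite [X in X - _ - _](divz_eq _ q) -/d -/r; ring.
  have [k ->] : exists k, j = (k + N.+3)%N by exists (j - N.+3)%N; rewrite subnK.
  rewrite /P1 /f !coefE nth_default ?(leq_trans sP) ?leq_addl //.
  have /gtn_eqF -> : (N.+2 < k + N.+3)%N by rewrite leq_addl.
  rewrite -[N.+3]/(3 + N)%N addnA addnK ltnNge leq_addl [(k + 3)%N]addnC /=.
  by ring.
have r0 : 0 <= r by rewrite modz_ge0 // gt_eqF.
exists (P2 + r *: 'X^(N.+2)); split.
- rewrite (leq_trans (size_polyD _ _)) // geq_max (leqW sP2) /=.
  by rewrite (leq_trans (size_scale_leq _ _)) // size_polyXn.
- rewrite evalzD P2E /P1 /f !evalzE zE.
  by ring.
- move=> j j2; rewrite coefD coefZ coefXn.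
  have [->|jN] := eqVneq j N.+2.
    by rewrite mulr1 nth_default // add0r ger0_norm // ltW // ltz_pmod.
  by rewrite mulr0 addr0; exact: P2q.
Qed.

(** By the relation q (z^2 + 1) = p z, so q (u (z^2 + 1) + v z) = (u p + v q) z = z for Bézout
    coefficients u and v. *)
Lemma divisor_value (K : fieldType) (z : K) (p q : int) :
    (q%:~R : K) != 0 -> coprimez p q ->
    q%:~R * z ^+ 2 = p%:~R * z - q%:~R ->
  exists2 g : {poly int}, (size g <= 3)%N & evalz g z = z / q%:~R.
Proof.
move=> q0 pq zE.
have [u [v uv]] := Bezoutz p q; rewrite (eqP pq) in uv.
exists (u *: ('X^2 + 1) + v *: 'X).
  rewrite (leq_trans (size_polyD _ _)) // geq_max; apply/andP; split.
    by rewrite (leq_trans (size_scale_leq _ _)) // size_XnaddC.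
  by rewrite (leq_trans (size_scale_leq _ _)) // size_polyX.
rewrite -polyC1 !evalzE.
have uvK : u%:~R * p%:~R + v%:~R * q%:~R = 1 :> K by rewrite -!intrM -intrD uv.
apply: (mulIf q0); rewrite divfK //.
have -> : (u%:~R * (z ^+ 2 + 1) + v%:~R * z) * q%:~R =
  u%:~R * (q%:~R * z ^+ 2) + u%:~R * q%:~R + v%:~R * q%:~R * z by ring.
rewrite zE; transitivity ((u%:~R * p%:~R + v%:~R * q%:~R) * z); first by ring.
by rewrite uvK mul1r.
Qed.

(** * Approximation of the unit disc by polynomials of linear weight *)

Section approximation.
Context {R : realType}.
Implicit Types (t : R) (w : R[i]).

Lemma poly_value_evalz t D (P : {poly int}) : (size P <= D.+1)%N ->
  poly_value (fun j : 'I_D.+1 => P`_j) t = evalz P (expi t).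
Proof.
move=> sP; rewrite (@horner_coef_wide _ D.+1); last first.
  exact: leq_trans (size_poly _ _) sP.
by apply: eq_bigr => j _; rewrite coef_map expiX.
Qed.

(* Once the coefficients of index at least 2 are bounded, those of index 0 and 1
   are the coordinates of a bounded number in the real basis [1, e^{it}]. *)
Lemma coef_sum_bound t (c : nat -> int) N (q M : R) :
    sin t != 0 -> 0 <= q -> 0 <= M ->
    normc (\sum_(j < N.+2) (c j)%:~R * expi t ^+ j) <= M ->
    (forall j, (2 <= j)%N -> `|c j|%:~R <= q) ->
  \sum_(j < N.+2) (1 + `|c j|%:~R) <=
    (q + 1 + (q + M) * (1 + 2 / `|sin t|)) * N.+2%:R.
Proof.
move=> s0 q0 M0; rewrite !big_ord_recl /= expr0 mulr1 expr1.
set T := \sum_(i < N) _%:~R * _ => sM cq.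
have Tq : normc T <= N%:R * q.
  rewrite /T -[N in N%:R]card_ord -sum1_card natr_sum mulr_suml.
  elim/big_ind2 : _ => [|x a y b hx hy|j _].
  - by rewrite ComplexField.Normc.normc0.
  - exact: le_trans (ler_normcD _ _) (lerD hx hy).
  - by rewrite normcM normcX normc_expi expr1n mulr1 mul1r normc_int -intr_norm cq.
have sTq : \sum_(i < N) (1 + `|c (bump 0 (bump 0 i))|%:~R : R) <= N%:R * (1 + q).
  rewrite -[N in N%:R]card_ord -sum1_card natr_sum mulr_suml ler_sum // => j _.
  by rewrite mul1r lerD2l cq.
rewrite !intr_norm.
have sgt0 : 0 < `|sin t| by rewrite normr_gt0.
(* Removing the tail [T] from the full sum leaves c_0 + c_1 e^{it}, of modulus at most [B]. *)
set B := M + N%:R * q.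
have c01 : normc ((c 0)%:~R + (c (bump 0 0))%:~R * expi t) <= B.
  rewrite (_ : _ + _ = ((c 0)%:~R + ((c (bump 0 0))%:~R * expi t + T)) - T); last by ring.
  by rewrite (le_trans (ler_normcD _ _)) // normcN lerD.
have c1B : `|(c (bump 0 0))%:~R| <= B / `|sin t| :> R.
  rewrite ler_pdivlMr // -normrM (le_trans _ c01) // (le_trans _ (ler_Im_normc _)) //.
  rewrite -!(rmorph_int (real_complex R)) /= /expi.
  by simpc.
have c0B : `|(c 0)%:~R| <= B + B / `|sin t| :> R.
  rewrite -normc_int (_ : (c 0)%:~R =
    ((c 0)%:~R + (c (bump 0 0))%:~R * expi t) - (c (bump 0 0))%:~R * expi t); last by ring.
  rewrite (le_trans (ler_normcD _ _)) // normcN lerD //.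
  by rewrite normcM normc_expi mulr1 normc_int.
set v := `|sin t|^-1 in c0B c1B *.
have v0 : 0 <= v by rewrite invr_ge0.
have N0 : 0 <= N%:R :> R by [].
have BN : B <= (q + M) * N.+2%:R.
  by rewrite -[N.+2]addn2 natrD /B; nra.
have BvN : B * v <= (q + M) * N.+2%:R * v by rewrite ler_wpM2r.
rewrite -[N.+2]addn2 natrD in BN BvN *.
by nra.
Qed.

(** Multiplication by y = (z/q)^m shrinks the 2-dense lattice spanned by 1 and z to mesh 2 |y|, at
    most 2 / 2^m because q is at least 2. What matters is that [K] depends on neither m nor w: the
    weight is linear in m while the error decays exponentially. *)
Lemma lattice_approximation t (p q : int) :
    sin t != 0 -> 1 < q -> coprimez p q -> q%:~R * (2 * cos t) = p%:~R ->
  exists K : nat, forall m w, normc w <= 1 ->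
    exists c : 'I_(2 * m).+2 -> int,
      (\sum_(j < (2 * m).+2) (1 + `|c j|) <= K * (2 * m).+2)%N /\
      normc (poly_value c t - w) <= 2 / 2 ^+ m.
Proof.
move=> s0 q1 pq cE; set z := expi t.
have qR0 : 0 < q%:~R :> R by rewrite ltr0z (lt_trans _ q1).
have qC0 : (q%:~R : R[i]) != 0 by rewrite intr_eq0 gt_eqF // (lt_trans _ q1).
have zE : q%:~R * z ^+ 2 = p%:~R * z - q%:~R.
  rewrite -(rmorph_int (real_complex R) p) -cE (rmorphM (real_complex R) q%:~R).
  by rewrite rmorph_int /z expi_sqr; ring.
have [g sg gE] := divisor_value _ _ _ _ qC0 pq zE.
(* This is the constant of [coef_sum_bound] with M = 3: the value lies within 2 of w, and w lies in
   the unit disc. *)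
pose X : R := q%:~R + 1 + (q%:~R + 3) * (1 + 2 / `|sin t|).
exists (Num.truncn X).+1 => m w w1.
have zq : normc (z / q%:~R) = q%:~R^-1.
  by rewrite normcM normc_expi mul1r ComplexField.Normc.normcV normc_int gtr0_norm.
pose y := (z / q%:~R) ^+ m.
have y0 : y != 0.
  rewrite expf_neq0 // mulf_neq0 ?invr_neq0 //.
  by apply/eqP => h; have := normc_expi t; rewrite -/z h ComplexField.Normc.normc0; lra.
have ny : normc y <= (2 ^+ m)^-1.
  rewrite /y normcX zq exprVn lef_pV2 ?posrE ?exprn_gt0 //.
  have q2 : 2 <= q%:~R :> R by rewrite -[2]/(2%:~R) ler_int.
  by rewrite lerXn2r ?nnegrE // ?ltW.
have [a [b ab]] := expi_lattice_net t (w / y) s0.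
pose l : {poly int} := b *: 'X + a%:P.
pose P : {poly int} := l * g ^+ m.
have sP : (size P <= (2 * m).+2)%N.
  rewrite (leq_trans (size_polyMleq _ _)) //.
  have h1 : (size l <= 2)%N.
    rewrite (leq_trans (size_polyD _ _)) // geq_max size_polyC.
    rewrite (leq_trans (size_scale_leq _ _)) ?size_polyX //=.
    by case: (a != 0).
  have h2 : (size (g ^+ m) <= (2 * m).+1)%N.
    rewrite (leq_trans (size_poly_exp_leq _ _)) // ltnS leq_mul //.
    by case: (size g) sg.
  by rewrite -subn1 leq_subLR addnC (leq_trans (leq_add h2 h1)) // addn2.
have [P' [sP' P'E P'q]] := reduce_coefs _ z p q _ _ (lt_trans ltr01 q1) zE sP.
have Pw : normc (evalz P' z - w) <= 2 / 2 ^+ m.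
  rewrite P'E /P evalzM /l evalz_exp gE -/y !evalzE.
  rewrite (_ : _ - w = (a%:~R + b%:~R * z - w / y) * y).
    by rewrite normcM ler_pM // normc_ge0.
  by rewrite mulrBl divfK // [b%:~R * z + _]addrC.
exists (fun j => P'`_j); split; last by rewrite poly_value_evalz.
rewrite -(ler_nat R) natr_sum.
under eq_bigr do rewrite natrD natr_absz.
have m1 : 1 <= 2 ^+ m :> R by rewrite exprn_ege1 // ler1n.
apply: le_trans (coef_sum_bound t (fun j => P'`_j) (2 * m) q%:~R 3 s0 _ _ _ _) _.
- exact: ltW.
- by [].
- have -> : \sum_(j < (2 * m).+2) (P'`_j)%:~R * expi t ^+ j = evalz P' z.
    rewrite -(@poly_value_evalz _ (2 * m).+1) //.
    by apply: eq_bigr => j _; rewrite expiX.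
  rewrite -[evalz P' z](subrK w) (le_trans (ler_normcD _ _)) //.
  suff : 2 / 2 ^+ m <= 2 :> R by lra.
  by rewrite ler_pdivrMr ?(lt_le_trans ltr01) // ler_pMr.
- by move=> j j2; rewrite ler_int P'q.
- rewrite natrM ler_wpM2r // ltW //; exact: truncnS_gt.
Qed.

End approximation.

(** * Stability of the logarithm under small relative errors *)

Section polar_form.
Context {R : realType}.
Implicit Types (x y r t : R) (v w : R[i]).

(** In the right half-plane the argument of a + ib is atan (b / a), so continuity of [atan] at 0 and
    of [ln] at 1 suffices. *)
Lemma polar_near1 (d : R) : 0 < d -> exists2 e : R, 0 < e &
  forall v, normc (v - 1) <= e -> exists r t,
    [/\ 0 < r, v = r%:C%C * expi t, `|ln r| < d & `|t| < d].
Proof.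
move=> d0.
have /cvgrPdist_lt /(_ d d0) [d1 /= d10 atan_d] := @continuous_atan R 0.
have /cvgrPdist_lt /(_ d d0) [d2 /= d20 ln_d] := @continuous_ln R 1 ltr01.
(* The bound 1/2 forces a >= 1/2, so that |b| <= d1 / 4 gives |b / a| < d1; the bound d2 / 2
   controls | |v| - 1 |. *)
exists (Num.min (1 / 2) (Num.min (d1 / 4) (d2 / 2))).
  by rewrite !lt_min !divr_gt0.
case=> a b; rewrite !le_min => /and3P[e1 e2 e3].
have a1 := le_trans (ler_Re_normc _) e1; have b2 := le_trans (ler_Im_normc _) e2.
rewrite /= oppr0 addr0 in a1 b2.
have a_gt : 1 / 2 <= a by move: a1; rewrite ler_norml; lra.
have a0 : 0 < a by lra.
pose t := atan (b / a).
have cost : 0 < cos t by rewrite cos_atan invr_gt0 sqrtr_gt0 ltr_wpDr ?sqr_ge0.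
have vE : (a +i* b)%C = (a / cos t)%:C%C * expi t.
  rewrite /expi /real_complex_def; simpc.
  rewrite divfK ?gt_eqF // -mulrA [_^-1 * _]mulrC -/(tan t) atanK.
  by rewrite mulrC divfK // gt_eqF.
have r0 : 0 < a / cos t by rewrite divr_gt0.
exists (a / cos t), t; split => //.
- rewrite -normrN -[- _]add0r -(ln1 R); apply: ln_d.
  have -> : a / cos t = normc (a +i* b)%C.
    by rewrite vE normcM normc_expi mulr1 normc_real gtr0_norm.
  apply: (@le_lt_trans _ _ (normc ((a +i* b)%C - 1))); last by lra.
  rewrite ler_norml; apply/andP; split.
    have := ler_normcD (1 : R[i]) ((a +i* b)%C - 1).
    by rewrite addrC subrK ComplexField.Normc.normc1; lra.
  have := ler_normcD (a +i* b)%C (1 - (a +i* b)%C).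
  rewrite addrC subrK ComplexField.Normc.normc1 -[1 - (_ +i* _)%C]opprB normcN; lra.
- rewrite -normrN -[- _]add0r -(@atan0 R); apply: atan_d.
  rewrite /= sub0r normrN normrM normfV (gtr0_norm a0) ltr_pdivrMr //.
  by nra.
Qed.

Lemma clog_polar r t : 0 < r -> 0 <= t < pi *+ 2 ->
  r%:C%C * expi t != 0 /\ clog (r%:C%C * expi t) = (ln r +i* t)%C.
Proof.
move=> r0 tI.
have nE : normc (r%:C%C * expi t) = r.
  by rewrite normcM normc_expi mulr1 normc_real gtr0_norm.
have n0 : r%:C%C * expi t != 0.
  apply: contraTneq r0 => h.
  by rewrite -nE h ComplexField.Normc.normc0 ltxx.
by split=> //; rewrite /clog (arg_unique n0 tI) ?nE.
Qed.

(* The argument of a target close to the branch cut is first moved away from it. *)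
Lemma clog_net : exists2 e : R, 0 < e &
  forall x y, 0 <= y <= pi *+ 2 -> exists2 w, normc w = expR x &
    forall s, normc (s - w) <= e * expR x ->
      s != 0 /\ normc ((x +i* y)%C - clog s) <= 1 / 10.
Proof.
(* Three errors of at most 1/40 add up to less than 1/10: in the log-modulus, in the argument, and
   from moving y to [y']. The margin 1/40 around the cut also keeps [y' + t] in [0, 2 pi). *)
have [|e e0 polar] := polar_near1 (1 / 40); first lra.
exists e => // x y yI.
have pi2 := pi_ge2 R.
have [y' y'I yy'] : exists2 y', 1 / 40 <= y' <= pi *+ 2 - 1 / 40 & `|y - y'| <= 1 / 40.
  have [y1|y1] := leP y (1 / 40).
    by exists (1 / 40); [|rewrite ler_norml]; lra.
  have [y2|y2] := leP (pi *+ 2 - 1 / 40) y.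
    by exists (pi *+ 2 - 1 / 40); [|rewrite ler_norml]; lra.
  by exists y; [lra|rewrite subrr normr0]; lra.
pose w := (expR x)%:C%C * expi y'.
have nw : normc w = expR x.
  by rewrite normcM normc_expi mulr1 normc_real gtr0_norm ?expR_gt0.
have w0 : w != 0.
  apply/eqP => h; have := expR_gt0 x.
  by rewrite -nw h ComplexField.Normc.normc0 ltxx.
exists w => // s sw.
have [|r [t [r0 vE lnr tI]]] := polar (s / w).
  rewrite (_ : s / w - 1 = (s - w) / w); last by rewrite mulrBl divff.
  by rewrite normcM ComplexField.Normc.normcV nw ler_pdivrMr ?expR_gt0.
have sE : s = (expR x * r)%:C%C * expi (y' + t).
  rewrite -[LHS](divfK w0) vE /w rmorphM expiD; ring.
have yt : 0 <= y' + t < pi *+ 2 by move: tI; rewrite ltr_norml; lra.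
have [s0 cE] := clog_polar _ _ (mulr_gt0 (expR_gt0 x) r0) yt.
rewrite sE; split=> //; rewrite cE lnM ?posrE ?expR_gt0 // expRK.
apply: le_trans (normc_le_Re_Im _) _.
rewrite /= opprD addrA subrr sub0r normrN.
have : `|y - (y' + t)| <= `|y - y'| + `|t|.
  by rewrite opprD addrA; exact: ler_normB.
lra.
Qed.

End polar_form.

(** * Arithmetic of the cosine and choice of the degree *)

Lemma rational_cos (R : realType) (t : R) :
    (range (@ratr R) `\` range (fun k : int => k%:~R / 2)) (cos t) ->
  sin t != 0 /\ exists p q : int,
    [/\ 1 < q, coprimez p q & q%:~R * (2 * cos t) = p%:~R].
Proof.
case=> -[x _ xE] nhalf.
(* An integral 2 cos t is excluded. This rules out both sin t = 0, where 2 cos t is 2 or -2, and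
   denominator 1. *)
have half (k : int) : 2 * cos t = k%:~R -> False.
  by move=> kE; apply: nhalf; exists k => //; rewrite -kE mulrAC divff ?mul1r.
split.
  apply/eqP => s0; have := cos2Dsin2 t; rewrite s0 expr0n addr0.
  move=> /eqP; rewrite sqrf_eq1 => /orP[] /eqP cE.
    by apply: (half 2); rewrite cE mulr1.
  by apply: (half (-2)); rewrite cE mulrN1 intrN.
pose x2 : rat := 2 * x.
have x2E : ratr x2 = 2 * cos t by rewrite rmorphM /= ratr_nat xE.
have qE : (denq x2)%:~R * (2 * cos t) = (numq x2)%:~R.
  by rewrite -x2E /ratr mulrC divfK // intr_eq0 denq_neq0.
exists (numq x2), (denq x2); split=> //; last exact: coprime_num_den.
have := denq_gt0 x2; rewrite gtz0_ge1 le_eqVlt => /predU1P[q1|//].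
by case: (half (numq x2)); rewrite -qE -q1 mul1r.
Qed.

(** With m about n / (4 (K + 1)), the weight K (2 m + 2) fits into n, and the error 2 / 2^m must
    beat the smallest modulus exp(- c n) in the rectangle. *)
Lemma DPV_expR (R : realType) (t : R) (p q : int) :
    sin t != 0 -> 1 < q -> coprimez p q -> q%:~R * (2 * cos t) = p%:~R ->
  exists2 c : R, 0 < c & \forall n \near \oo,
    forall r, ln r <= c * n%:R -> DPV n r t.
Proof.
move=> s0 q1 pq cE.
have [K approx] := lattice_approximation _ _ _ s0 q1 pq cE.
have [e e0 net] := @clog_net R.
pose L : R := ln 2; have L0 : 0 < L by rewrite ln_gt0 ?ltr1n.
pose k : R := K.+1%:R; have k0 : 0 < k by rewrite ltr0n.
(* As m + 1 >= n / (4 k), this choice gives (m + 1) ln 2 >= 2 c n: one c n pays for [ln r], the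
   other for the constant L + ln (2 / e). *)
pose c := L / (8 * k); have c0 : 0 < c by rewrite divr_gt0 ?mulr_gt0.
exists c => //.
near=> n => r rn [x y] [/= xI yI].
pose m := (n %/ (4 * K.+1))%N.
(* For m >= 1 one has 2 m + 2 <= 4 m, which the final weight bound uses. *)
have m1 : (1 <= m)%N by rewrite divn_gt0 //; near: n; exact: nbhs_infty_ge.
have mn : n%:R <= 4 * k * (m%:R + 1).
  rewrite /k natr1 -!natrM ler_nat mulnC.
  by apply: ltnW; rewrite ltn_ceil.
have [w nw wP] := net x y yI.
have [|C [Csum Cw]] := approx m w.
  by rewrite nw -expR0 ler_expR; case/andP: xI.
have small : 2 / 2 ^+ m <= e * expR x.
  have -> : (2 ^+ m : R) = expR (m%:R * L) by rewrite expRM_natl lnK ?posrE.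
  rewrite ler_pdivrMr ?expR_gt0 // -mulrA -expRD -ler_pdivrMl // mulrC.
  rewrite -[leLHS]lnK ?posrE ?divr_gt0 // ler_expR.
  have h1 : (L + ln (2 / e)) <= n%:R * c by rewrite -ler_pdivrMr //; near: n; exact: nbhs_infty_ger.
  have h2 : n%:R * c * 2 <= (m%:R + 1) * L.
    rewrite (_ : n%:R * c * 2 = n%:R / (4 * k) * L); last by rewrite /c; field; exact: lt0r_neq0.
    by rewrite ler_pM2r // ler_pdivrMr ?mulr_gt0 // mulrC.
  case/andP: xI => xr _.
  move: h1 h2 xr rn; clearbody c L; clear; lra.
have [S0 Sxy] := wP _ (le_trans Cw small).
exists (clog (poly_value C t)) => //.
exists (2 * m).+1, C; split=> //.
rewrite (leq_trans Csum) //.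
apply: (@leq_trans (m * (4 * K.+1))%N); last exact: leq_divM.
move: m1; clearbody m; clear; nia.
Unshelve. all: by end_near.
Qed.

Theorem proposition1p6 (R : realType) (theta : R)
    (htheta : 0 <= theta < pi *+ 2)
    (hcos : (range (@ratr R) `\` range (fun k : int => k%:~R / 2))
              (cos theta)) :
  exists2 c : R, 0 < c &
    \forall n \near \oo,
      (forall r : R, r < expR (c * n%:R / ln n%:R ^+ 2) -> DPV n r theta) /\
      ((expR (c * n%:R / ln n%:R ^+ 2))%:E <= R_DPV n theta)%E.
Proof.
have [s0 [p [q [q1 pq cE]]]] := rational_cos _ _ hcos.
have [c c0 H] := DPV_expR _ _ _ _ s0 q1 pq cE.
exists c => //; near=> n.
(* Including equality makes the bound itself a member of the set whose supremum is [R_DPV]. *)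
have D r : r <= expR (c * n%:R / ln n%:R ^+ 2) -> DPV n r theta.
  move=> rE; apply: (near H) => //.
  (* For r <= 0 the default value [ln r = 0] applies. *)
  have [r0|r0] := leP r 0; first by rewrite ln0 // mulr_ge0 // ltW.
  rewrite (@le_trans _ _ (c * n%:R / ln n%:R ^+ 2)) //.
    by rewrite -[leRHS]expRK ler_ln ?posrE ?expR_gt0.
  (* Once n >= e, dividing by (ln n)^2 only lowers the exponent c n. *)
  have ln1 : 1 <= ln n%:R :> R.
    rewrite -[leLHS]expRK ler_ln ?posrE ?expR_gt0 //; first by near: n; exact: nbhs_infty_ger.
    by rewrite (lt_le_trans (expR_gt0 1)) //; near: n; exact: nbhs_infty_ger.
  have l2 : 1 <= ln n%:R ^+ 2 :> R by rewrite exprn_ege1.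
  rewrite ler_pdivrMr ?(lt_le_trans ltr01) //.
  by rewrite ler_peMr // mulr_ge0 // ltW.
split=> [r rlt|]; first by apply: D; exact: ltW.
by apply: ereal_sup_ubound; exists (expR (c * n%:R / ln n%:R ^+ 2)) => //; exact: D.
Unshelve. all: by end_near.
Qed.
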